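(* Let $U=\{s\in\mathbb{C}:\operatorname{Re}s>1\}$. For $\theta\in[0,\pi]$ and $\mathbf{x}\in\mathbb{R}^{\infty}$ put $$\sigma_{\theta}^{\mathbf{x}}:=\sup\{\sigma>1:|\operatorname{Arg}(\zeta_{\mathbf{x}}(\sigma+it))|=\theta\text{ for some }\sigma+it\in U\},$$ and let $\sigma_{\theta}^{\boldsymbol{\frac{\pi}{2}}}$ and $\sigma_{\theta}^{\boldsymbol{-\frac{\pi}{2}}}$ denote this quantity for the constant sequences $\mathbf{x}=(\frac{\pi}{2},\frac{\pi}{2},\ldots)$ and $\mathbf{x}=(-\frac{\pi}{2},-\frac{\pi}{2},\ldots)$, respectively. Then, for every $\theta\in[0,\pi]$ and every $\mathbf{x}\in\mathbb{R}^{\infty}$, $$\sigma_{\theta}^{\mathbf{x}}\leq\sigma_{\theta}^{\boldsymbol{\frac{\pi}{2}}}=\sigma_{\theta}^{\boldsymbol{-\frac{\pi}{2}}}.$$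
   Context: Let $p_k$ denote the $k$-th prime number. $\mathbb{R}^{\infty}$ is the set of all real sequences $\mathbf{x}=(x_1,x_2,\ldots)$. For $\mathbf{x}\in\mathbb{R}^{\infty}$ define, for $\operatorname{Re}s>1$, $$\zeta_{\mathbf{x}}(s)=\sum_{n\ge1}\frac{e^{i\langle\mathbf{r}_n,\mathbf{x}\rangle}}{n^{s}},$$ where, if $n=\prod_k p_k^{\alpha_k}$ is the prime factorization of $n$, $\mathbf{r}_n=(\alpha_1,\alpha_2,\ldots)$ and $\langle\mathbf{r}_n,\mathbf{x}\rangle=\sum_k\alpha_k x_k$ (a finite sum). The series converges absolutely for $\operatorname{Re}s>1$, and $\zeta_{\mathbf{x}}$ has no zeros there. $\operatorname{Arg}$ is the principal argument, with values in $(-\pi,\pi]$. Suprema are taken in the extended real line (the value $+\infty$ is allowed). *)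

(* Defs.v *)
From HB Require Import structures.
From mathcomp Require Import all_boot all_order all_algebra.
From mathcomp Require Import all_classical all_reals all_analysis.
From mathcomp Require Export complex.

Set Implicit Arguments.
Unset Strict Implicit.
Unset Printing Implicit Defensive.

Import Order.TTheory GRing.Theory Num.Theory.
Import numFieldNormedType.Exports.

Local Open Scope classical_set_scope.
Local Open Scope ring_scope.
Local Open Scope complex_scope.

Lemma ex_prime_gt (m : nat) : exists p, (m < p)%N && prime p.
Proof. by have [p mp pp] := prime_above m; exists p; rewrite mp. Qed.

(* Numbering starts at 0: [nth_prime k] is $p_{k+1}$, and accordingly a
   sequence $(x_1, x_2, \ldots)$ is a function [x : nat -> R] with [x k]
   standing for $x_{k+1}$. *)
Fixpoint nth_prime (k : nat) : nat :=
  if k is j.+1 then ex_minn (ex_prime_gt (nth_prime j)) else 2%N.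

Section Twisted_zeta.
Variable R : realType.
Implicit Types (x : nat -> R) (s z : R[i]) (n : nat) (a theta : R).

Definition exponent_vector n (k : nat) : nat := logn (nth_prime k) n.

(* A sum over the (finite, when [n > 0]) support of the summand. *)
Definition pairing n x : R :=
  \sum_(k \in [set: nat]) ((exponent_vector n k)%:R * x k).

Definition expC z : R[i] :=
  (expR (complex.Re z))%:C * (cos (complex.Im z) +i* sin (complex.Im z)).

(* $n^s = \exp(s \log n)$, used for [n > 0] only. *)
Definition natpowC n s : R[i] := expC (s * (ln n%:R)%:C).

Definition zeta_term x s n : R[i]^o :=
  expC ('i * (pairing n x)%:C) / natpowC n s.

(* The sum starts at [n = 1]; meaningful for $\mathrm{Re}\, s > 1$. *)
Definition zeta x s : R[i] :=
  lim (series (fun n => zeta_term x s n.+1) @ \oo).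

(* The principal argument; the value at 0 is arbitrary (see [ArgP] and
   [Arg_unique] for the others). *)
Definition Arg z : R :=
  xget 0 [set a | - pi < a <= pi /\ z = `|z| * expC ('i * a%:C)].

Lemma expC_im a : expC ('i * a%:C) = cos a +i* sin a.
Proof. by rewrite /expC; simpc; rewrite expR0 !mul1r. Qed.

Lemma Arg_exists z : z != 0 ->
  exists a, - pi < a <= pi /\ z = `|z| * expC ('i * a%:C).
Proof.
case: z => u v; rewrite eq_complex /= negb_and => uv0.
rewrite normc_def /=; set r := Num.sqrt _.
have uv_gt0 : 0 < u ^+ 2 + v ^+ 2.
  rewrite lt_neqAle addr_ge0 ?sqr_ge0// andbT eq_sym.
  by rewrite paddr_eq0 ?sqr_ge0// !sqrf_eq0 negb_and.
have r0 : 0 < r by rewrite sqrtr_gt0.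
have r2 : r ^+ 2 = u ^+ 2 + v ^+ 2 by rewrite sqr_sqrtr// ltW.
have ur : u ^+ 2 <= r ^+ 2 by rewrite r2 lerDl sqr_ge0.
have c1 : -1 <= u / r <= 1.
  by rewrite -ler_norml normf_div (gtr0_norm r0) ler_pdivrMr// mul1r
     -[leRHS](gtr0_norm r0) -ler_sqr ?nnegrE// !real_normK ?num_real.
have sE : Num.sqrt (1 - (u / r) ^+ 2) = `|v| / r.
  have -> : 1 - (u / r) ^+ 2 = (v / r) ^+ 2.
    by rewrite !expr_div_n r2 -(@divff _ (u ^+ 2 + v ^+ 2)) ?gt_eqF// -mulrBl addrAC subrr add0r.
  by rewrite sqrtr_sqr normf_div (gtr0_norm r0).
have rK y : r * (y / r) = y by rewrite mulrC divfK// gt_eqF.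
have [v0|v0] := leP 0 v.
  exists (acos (u / r)); split.
    rewrite acos_lepi// andbT (lt_le_trans _ (acos_ge0 c1))// oppr_lt0 pi_gt0//.
  by rewrite expC_im acosK// sin_acos// sE ger0_norm//; simpc; rewrite !rK.
exists (- acos (u / r)); split.
  rewrite ltrN2 (le_trans (y := 0)) ?oppr_le0 ?acos_ge0 ?pi_ge0// andbT.
  apply: acos_ltpi; case/andP: c1 => c0 ->; rewrite andbT lt_neqAle c0 andbT.
  apply/negP => /eqP cE; move/eqP: sE; rewrite -cE sqrrN expr1n subrr sqrtr0.
  by rewrite eq_sym mulf_eq0 invr_eq0 (gt_eqF r0) orbF normr_eq0 (lt_eqF v0).
by rewrite expC_im cosN sinN acosK// sin_acos// sE ltr0_norm//; simpc; rewrite ?(mulrN, mulNr) ?opprK !rK.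
Qed.

Lemma ArgP z : z != 0 ->
  - pi < Arg z <= pi /\ z = `|z| * expC ('i * (Arg z)%:C).
Proof. by move=> /Arg_exists; exact: xgetPex. Qed.

Lemma Arg_unique z a : z != 0 ->
  - pi < a <= pi -> z = `|z| * expC ('i * a%:C) -> Arg z = a.
Proof.
move=> z0 apb za; have [bpb zb] := ArgP z0; set b := Arg z in bpb zb *.
have : `|z| * expC ('i * a%:C) = `|z| * expC ('i * b%:C) by rewrite -za -zb.
move/(mulfI _); rewrite normr_eq0 => /(_ z0); rewrite !expC_im => -[cab sab].
have neg (c : R) : - pi < c -> c < 0 -> sin c < 0.
  by move=> pc c0; rewrite -oppr_gt0 -sinN sin_gt0_pi// oppr_gt0 c0/= ltrNl.
case/andP: apb bpb => pa ap /andP[pb bp].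
have [a0|a0] := leP 0 a; have [b0|b0] := leP 0 b.
- by apply: cos_inj; rewrite ?in_itv/= ?a0 ?b0.
- have := neg _ pb b0; rewrite -sab => /lt_geF; rewrite sin_ge0_pi// ?a0 ?ap//.
- have := neg _ pa a0; rewrite sab => /lt_geF; rewrite sin_ge0_pi// ?b0 ?bp//.
apply: oppr_inj; apply: cos_inj; rewrite ?cosN// in_itv/= oppr_ge0 lerNl ltW//=.
  exact: ltW.
exact: ltW.
Qed.

Definition sigma theta x : \bar R :=
  ereal_sup [set sig%:E | sig in
    [set sig : R | 1 < sig /\ exists t : R, `|Arg (zeta x (sig +i* t))| = theta]].

End Twisted_zeta.

(* Main.v *)
(* Every [x] gives the same value. On the abscissa [s > 1] the Euler product
   yields an argument [zeta_arg x s t = \sum_k arg (1 / (1 - z_k))] of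
   [zeta x (s + i t)], where [z_k = p_k ^ (- s) * exp (i (x_k - t * ln p_k))],
   and each summand is at most [asin (p_k ^ (- s))] in absolute value. As the
   [ln p_k] are linearly independent over the rationals, Kronecker's theorem
   makes both extreme values [+- \sum_k asin (p_k ^ (- s))] approachable along
   the vertical line, for every [x]. These bounds strictly increase when [s]
   decreases; so if [|Arg| = theta] occurs at abscissa [s0] for some [x], then
   by the intermediate value theorem in [t] the value [theta] is taken by
   [zeta_arg y s1] for every [y] and every [1 < s1 < s0]. *)
Require Import Defs.
From mathcomp Require Import all_boot all_order all_algebra.
From mathcomp Require Import all_classical all_reals all_analysis.
From mathcomp Require Import ring lra zify.

Set Implicit Arguments.
Unset Strict Implicit.
Unset Printing Implicit Defensive.

Import Order.TTheory GRing.Theory Num.Theory.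
Import numFieldNormedType.Exports.

Local Open Scope ring_scope.
Local Open Scope complex_scope.

Definition cis (R : realType) (a : R) : R[i] := cos a +i* sin a.

(** * Kronecker's theorem *)

Section Kronecker.
Variable R : realType.
Implicit Types (a b t : R) (z : R[i]).

Lemma cis0 : cis 0 = 1 :> R[i].
Proof. by rewrite /cis cos0 sin0. Qed.

Lemma cisD a b : cis (a + b) = cis a * cis b.
Proof. by rewrite /cis cosD sinD; simpc; rewrite [sin a * cos b + _]addrC. Qed.

Lemma cispi : cis pi = -1 :> R[i].
Proof. by rewrite /cis cospi sinpi; simpc. Qed.

Lemma normr_cis a : `|cis a| = 1.
Proof. by rewrite normc_def /= cos2Dsin2 sqrtr1. Qed.

Lemma cis_sum (I : finType) (F : I -> R) :
  cis (\sum_i F i) = \prod_i cis (F i).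
Proof. exact: (big_morph _ cisD cis0). Qed.

(* Averaging a trigonometric polynomial with its translate by [pi / l i] kills
   the frequency [l i] and fixes the constant term. *)
Lemma trig_mean0 (I : finType) (c : I -> R[i]) (l : I -> R) (L : R[i]) :
  (forall t, `|\sum_i c i * cis (l i * t)| <= L) ->
  `|\sum_(i | l i == 0) c i| <= L.
Proof.
have [m] := ubnP #|[pred i | (l i != 0) && (c i != 0)]|.
elim: m c => // m IHm c cm cL.
have [i0 /andP[/= li0 ci0]|noi] :=
    pickP [pred i | (l i != 0) && (c i != 0)]; last first.
  have := cL 0; under eq_bigr do rewrite mulr0 cis0 mulr1.
  congr (_ <= _); congr `|_|; rewrite [RHS]big_mkcond /=; apply: eq_bigr => i _.
  by move: (noi i) => /=; case: eqP => //= _ /negbFE/eqP.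
pose c' i := c i * ((1 + cis (l i * (pi / l i0))) / 2).
have <- : \sum_(i | l i == 0) c' i = \sum_(i | l i == 0) c i.
  apply: eq_bigr => i /eqP li; rewrite /c' li mul0r cis0.
  by rewrite divff ?mulr1// pnatr_eq0.
apply: IHm.
  rewrite ltnS in cm; apply: leq_trans cm; apply/proper_card/properP; split.
    apply/fintype.subsetP => i; rewrite !inE /c' => /andP[->].
    by rewrite mulf_eq0 negb_or => /andP[].
  exists i0; rewrite !inE ?li0 ?ci0//= negbK /c'.
  by rewrite [l i0 * _]mulrC divfK// cispi subrr mul0r mulr0.
move=> t; have -> : \sum_i c' i * cis (l i * t) =
    (\sum_i c i * cis (l i * t) +
     \sum_i c i * cis (l i * (t + pi / l i0))) / 2.
  rewrite -big_split mulr_suml; apply: eq_bigr => i _ /=.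
  by rewrite /c' mulrDr cisD; ring.
rewrite normrM normfV normr_nat ler_pdivrMr ?ltr0n//.
by rewrite (le_trans (ler_normD _ _))// mulr_natr mulr2n lerD.
Qed.

(** Multiplying by [cis (- mu * t)] moves the frequency [mu] to zero and leaves the modulus
    unchanged. *)
Lemma trig_mean (I : finType) (c : I -> R[i]) (l : I -> R) (L : R[i]) (mu : R) :
  (forall t, `|\sum_i c i * cis (l i * t)| <= L) ->
  `|\sum_(i | l i == mu) c i| <= L.
Proof.
move=> cL; rewrite (eq_bigl (fun i => l i - mu == 0)); last first.
  by move=> i; rewrite subr_eq0.
apply: trig_mean0 => t; apply: le_trans (cL t).
rewrite -[leRHS]mulr1 -(normr_cis (- mu * t)) -normrM mulr_suml.
by under eq_bigr do rewrite mulrDl cisD mulrA.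
Qed.

(** Bernoulli gives [m * d <= (1 + d) ^+ m]. With [k = N.+1 * m], the power [q ^+ k] is thus at
    least [(m * d) ^+ N.+1], of degree [N + 1] in [m], while [k.+1 ^ N] is at most [(N.+2 * m) ^ N];
    [D] is the threshold for [m]. *)
Lemma exp_gt_poly (q : R) (N : nat) : 1 < q ->
  exists k : nat, (k.+1 ^ N)%:R < q ^+ k.
Proof.
move=> q1; pose d := q - 1; have d0 : 0 < d by rewrite subr_gt0.
pose D := (N.+2 ^ N)%:R / d ^+ N.+1; have D0 : 0 <= D.
  by rewrite divr_ge0// exprn_ge0// ltW.
pose m := (Num.trunc D).+1; have Dm : D < m%:R by rewrite truncnS_gt.
exists (N.+1 * m)%N.
have mg : (0 < m)%N by [].
apply: (@lt_le_trans _ _ ((m%:R * d) ^+ N.+1)).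
  apply: (@le_lt_trans _ _ (((N.+2 * m) ^ N)%:R)).
    by rewrite !natrX lerXn2r ?nnegrE// ler_nat; lia.
  rewrite expnMn natrM exprMn [m%:R ^+ _]exprSr mulrC (natrX _ m) -mulrA.
  by rewrite ltr_pM2l ?exprn_gt0 ?ltr0n// -ltr_pdivrMr ?exprn_gt0.
rewrite mulnC exprM lerXn2r ?nnegrE ?mulr_ge0 ?exprn_ge0 ?(ltW d0)//.
  by rewrite (le_trans _ (ltW q1)).
have -> : q = 1 + d by rewrite addrC subrK.
elim: (m) => [|j IHj]; first by rewrite mul0r expr0.
have j0 : 0 <= j%:R :> R by [].
have : 1 <= (1 + d) ^+ j by rewrite exprn_ege1// lerDl ltW.
rewrite exprSr -[j.+1]addn1 natrD; nra.
Qed.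

Section Words.
Variables (N k : nat) (y l : 'I_N -> R).
Hypothesis l_free : forall a b : 'I_N -> nat,
  \sum_j (a j)%:R * l j = \sum_j (b j)%:R * l j -> a =1 b.

(* A word picks a summand of [1 + \sum_j cis (y j + l j * t)] in each of the
   [k] factors of the [k]-th power; [None] stands for the summand [1]. *)
Let word := {ffun 'I_k -> option 'I_N}.
Let cnt (w : word) : {ffun 'I_N -> 'I_k.+1} :=
  [ffun j => inord #|[pred i | w i == Some j]|].

Lemma word_sum (g : 'I_N -> R) (w : word) :
  \sum_i oapp g 0 (w i) = \sum_j (cnt w j)%:R * g j.
Proof.
transitivity (\sum_i \sum_j (w i == Some j)%:R * g j).
  apply: eq_bigr => i _; case: (w i) => [j|] /=.
    rewrite (bigD1 j)//= eqxx mul1r big1 ?addr0// => j' jj'.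
    by rewrite (inj_eq Some_inj) eq_sym (negbTE jj') mul0r.
  by rewrite big1// => j _; rewrite mul0r.
rewrite exchange_big /=; apply: eq_bigr => j _.
rewrite -mulr_suml; congr (_ * _); rewrite -natr_sum; congr _%:R.
rewrite ffunE inordK; last by rewrite ltnS -[leqRHS]card_ord max_card.
by rewrite -sum1_card [RHS]big_mkcond /=; apply: eq_bigr => i _; rewrite inE; case: eqP.
Qed.

Lemma bohr_bound L :
  (forall t, `|1 + \sum_j cis (y j + l j * t)| <= L%:C) ->
  N.+1%:R ^+ k <= (k.+1 ^ N)%:R * L ^+ k.
Proof.
move=> FL; pose Y (w : word) := \sum_i oapp y 0 (w i) : R.
pose lam (w : word) := \sum_i oapp l 0 (w i) : R.
have meanL mu : `|\sum_(w | lam w == mu) cis (Y w)| <= (L ^+ k)%:C.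
  apply: trig_mean => t.
  have -> : \sum_w cis (Y w) * cis (lam w * t) =
      (1 + \sum_j cis (y j + l j * t)) ^+ k.
    have -> : 1 + \sum_j cis (y j + l j * t) =
        \sum_o cis (oapp y 0 o + oapp l 0 o * t).
      rewrite [RHS](bigD1 None)//= mul0r addr0 cis0; congr (_ + _).
      by rewrite [RHS](reindex_omap Some id); [apply: eq_bigl => j; rewrite eqxx | case].
    rewrite -[in RHS](card_ord k) -prodr_const bigA_distr_bigA /=.
    apply: eq_bigr => w _; rewrite -cisD -cis_sum; congr cis.
    by rewrite big_split /= mulr_suml.
  by rewrite normrX rmorphXn /= lerXn2r ?nnegrE// (le_trans _ (FL 0)).
(* By [l_free], a frequency determines the letter counts, and these determine the coefficient. The
   words counted by [v] therefore add up without cancellation, to a unimodular number times their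
   cardinality. *)
have class_le (v : {ffun 'I_N -> 'I_k.+1}) :
    #|[pred w | cnt w == v]|%:R <= L ^+ k.
  rewrite -lecR; apply: le_trans (meanL (\sum_j (v j)%:R * l j)).
  rewrite (eq_bigl (fun w => cnt w == v)); last first.
    move=> w; rewrite /lam word_sum; apply/eqP/eqP => [/l_free wv|<-//].
    by apply/ffunP => j; apply/val_inj/wv.
  rewrite (eq_bigr (fun=> cis (\sum_j (v j)%:R * y j))); last first.
    by move=> w /eqP <-; rewrite /Y word_sum.
  by rewrite sumr_const normrMn normr_cis rmorph_nat.
have -> : N.+1%:R ^+ k = #|{: word}|%:R :> R.
  by rewrite card_ffun card_option !card_ord natrX.
have -> : #|{: word}| = \sum_v #|[pred w | cnt w == v]|.
  rewrite -sum1_card (partition_big cnt xpredT)//=.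
  by apply: eq_bigr => v _; rewrite -sum1_card.
rewrite natr_sum (le_trans (ler_sum _ (fun v _ => class_le v)))//.
by rewrite sumr_const card_ffun !card_ord mulr_natl.
Qed.

End Words.

(* Bohr's proof: the [k]-th power of [1 + \sum_j cis (y j + l j * t)] has
   coefficients whose absolute values add up to [(N + 1) ^ k], but at most
   [(k + 1) ^ N] frequencies. *)
Theorem kronecker (N : nat) (y l : 'I_N -> R) (e : R) :
  (forall a b : 'I_N -> nat,
    \sum_j (a j)%:R * l j = \sum_j (b j)%:R * l j -> a =1 b) ->
  0 < e -> exists t, forall j, 1 - e <= cos (y j + l j * t).
Proof.
move=> l_free e0; pose d := Num.min (e / 2) (1 / 2).
have d0 : 0 < d by rewrite lt_min !divr_gt0.
have d1 : d <= 1 / 2 by rewrite ge_min lexx orbT.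
have de : d <= e / 2 by rewrite ge_min lexx.
pose F t := 1 + \sum_j cis (y j + l j * t).
(* Otherwise [bohr_bound] would bound the powers of [N.+1 / (N.+1 - d)], a ratio above 1, by a
   polynomial in the exponent. *)
have [t Ft] : exists t, ~ (`|F t| <= (N.+1%:R - d)%:C).
  apply/existsNP => FL.
  have N1 : 1 <= N.+1%:R :> R by rewrite ler1n.
  have L0 : 0 < N.+1%:R - d by lra.
  have [|k kq] := @exp_gt_poly (N.+1%:R / (N.+1%:R - d)) N.
    by rewrite ltr_pdivlMr// mul1r; lra.
  have := bohr_bound k l_free FL; apply/negP; rewrite -ltNge.
  by rewrite -ltr_pdivlMr ?exprn_gt0// -expr_div_n.
exists t => j; set u := y j + _.
(* The other [N - 1] terms have modulus 1, so [1 + cis u] alone must have modulus above [2 - d].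
   Squaring gives [cos u > 1 - 2 * d], hence the choice [d <= e / 2]. *)
have Fj : `|F t| <= `|1 + cis u| + N.-1%:R.
  rewrite /F (bigD1 j)//= addrA -/u (le_trans (ler_normD _ _))// lerD2l.
  rewrite (le_trans (ler_norm_sum _ _ _))//.
  under eq_bigr do rewrite normr_cis.
  by rewrite sumr_const cardC1 card_ord.
have N0 : (0 < N)%N by apply: leq_ltn_trans (ltn_ord j).
have {}Fj : ~ (`|1 + cis u| <= (2 - d)%:C).
  move=> uF; apply: Ft; rewrite (le_trans Fj)//.
  have -> : N.+1%:R - d = (2 - d) + N.-1%:R.
    by case: (N) N0 => // m _; rewrite /= -[m.+2]addn2 natrD; ring.
  by rewrite rmorphD /= rmorph_nat lerD2r.
move: Fj; rewrite normc_def lecR /= add0r => /negP; rewrite -ltNge => ud.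
have : (2 - d) ^+ 2 < (1 + cos u) ^+ 2 + sin u ^+ 2.
  rewrite -[ltRHS]sqr_sqrtr ?addr_ge0 ?sqr_ge0//.
  by rewrite ltrXn2r ?nnegrE ?sqrtr_ge0//; lra.
have := cos2Dsin2 u; nra.
Qed.

End Kronecker.

Local Open Scope classical_set_scope.

(** * Sieving by the first primes *)

Section Primes.

Lemma prime_nth_prime k : prime (nth_prime k).
Proof. by case: k => //= j; case: ex_minnP => p /andP[]. Qed.

Lemma nth_prime_ltS k : (nth_prime k < nth_prime k.+1)%N.
Proof. by rewrite /=; case: ex_minnP => p /andP[]. Qed.

Lemma nth_prime_gt k : (k.+1 < nth_prime k)%N.
Proof. by elim: k => // k IHk; apply: leq_trans (nth_prime_ltS k). Qed.

Lemma nth_prime_inj : injective nth_prime.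
Proof.
apply/incn_inj/leq_mono/(homo_ltn ltn_trans)/nth_prime_ltS.
Qed.

Lemma nth_prime_onto p N : prime p -> (p < nth_prime N)%N ->
  exists2 k, (k < N)%N & nth_prime k = p.
Proof.
move=> pp; elim: N => [|N IHN]; first by case: p pp => [|[|]].
have [pN _|Np|pN _] := ltngtP p (nth_prime N).
- by have [k kN <-] := IHN pN; exists k => //; rewrite ltnW.
- rewrite ltnNge /=; case: ex_minnP => q _ /(_ p).
  by rewrite Np pp => ->.
- by exists N; rewrite ?pN.
Qed.

End Primes.

(** * Additivity of the pairing and unique factorization *)

Section Pairing.
Variable R : realType.
Implicit Types (x : nat -> R) (m n : nat).

(** Primes of index at least [K] exceed [n], so their exponents in [n] vanish. The freedom in [K]
    lets several integers share one range of summation. *)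
Lemma pairingE n K x : (0 < n <= K)%N ->
  pairing n x = \sum_(k < K) (logn (nth_prime k) n)%:R * x k.
Proof.
move=> /andP[n0 nK].
rewrite (@fsbig_ord _ _ _ K (fun k => (logn (nth_prime k) n)%:R * x k)).
rewrite /pairing; apply/esym/fsbig_widen => // k [_ /= kK].
rewrite /exponent_vector ltn_log0 ?mul0r//.
rewrite (leq_trans _ (ltnW (nth_prime_gt k)))// ltnS (leq_trans nK)//.
by rewrite leqNgt; apply/negP.
Qed.

Lemma pairingM m n x : (0 < m)%N -> (0 < n)%N ->
  pairing (m * n) x = pairing m x + pairing n x.
Proof.
move=> m0 n0; rewrite !(@pairingE _ (m * n)) ?muln_gt0 ?m0 ?n0 ?leqnn//=;
  rewrite ?leq_pmull ?leq_pmulr//.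
rewrite -big_split; apply: eq_bigr => k _ /=.
by rewrite lognM// natrD mulrDl.
Qed.

Lemma pairing_nth_prime k x : pairing (nth_prime k) x = x k.
Proof.
rewrite (@pairingE _ (nth_prime k)) ?prime_gt0 ?prime_nth_prime ?leqnn//.
have kp : (k < nth_prime k)%N by rewrite ltnW// nth_prime_gt.
rewrite (bigD1 (Ordinal kp))//= logn_prime ?prime_nth_prime// eqxx mul1r.
rewrite big1 ?addr0// => j jk; rewrite logn_prime ?prime_nth_prime//.
have jk' : (j : nat) == k = false.
  by apply: contraNF jk => /eqP jk; apply/eqP/val_inj.
by rewrite (inj_eq nth_prime_inj) jk' mul0r.
Qed.

(** Unique factorization: exponentiation turns the two sums into equal integers, whose prime
    exponents are [a] and [b]. *)
Lemma ln_prime_free N (a b : 'I_N -> nat) :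
  \sum_(j < N) (a j)%:R * ln (nth_prime j)%:R =
  \sum_(j < N) (b j)%:R * ln (nth_prime j)%:R :> R -> a =1 b.
Proof.
have gt0 (c : 'I_N -> nat) : (0 < \prod_(j < N) nth_prime j ^ c j)%N.
  by rewrite prodn_gt0// => j; rewrite expn_gt0 prime_gt0 ?prime_nth_prime.
have lnE (c : 'I_N -> nat) : \sum_(j < N) (c j)%:R * ln (nth_prime j)%:R =
    ln (\prod_(j < N) nth_prime j ^ c j)%:R :> R.
  pose ok s m := (0 < m)%N /\ s = ln m%:R :> R.
  suff [] : ok (\sum_(j < N) (c j)%:R * ln (nth_prime j)%:R)
    (\prod_(j < N) nth_prime j ^ c j)%N by [].
  apply: (big_rec2 ok) => [|j m s _ [m0 ->]]; first by split; rewrite ?ln1.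
  have pj : (0 < nth_prime j)%N by rewrite prime_gt0 ?prime_nth_prime.
  split; first by rewrite muln_gt0 expn_gt0 pj.
  rewrite natrM lnM ?posrE ?ltr0n ?expn_gt0 ?pj// natrX lnXn ?ltr0n//.
  by rewrite mulr_natl.
have lognE (c : 'I_N -> nat) (i : 'I_N) :
    logn (nth_prime i) (\prod_(j < N) nth_prime j ^ c j) = c i.
  pose ok s m := (0 < m)%N /\ logn (nth_prime i) m = s.
  suff [_ ->] : ok (\sum_(j < N) c j * (i == j))%N (\prod_(j < N) nth_prime j ^ c j)%N.
    rewrite (bigD1 i)//= eqxx muln1 big1 ?addn0// => j.
    by rewrite eq_sym => /negbTE ->; rewrite muln0.
  apply: (big_rec2 ok) => [|j m s _ [m0 <-]]; first by split; rewrite ?logn1.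
  have pj : (0 < nth_prime j)%N by rewrite prime_gt0 ?prime_nth_prime.
  split; first by rewrite muln_gt0 expn_gt0 pj.
  rewrite lognM ?expn_gt0 ?pj// lognX logn_prime ?prime_nth_prime//.
  by rewrite (inj_eq nth_prime_inj).
rewrite !lnE => /ln_inj; rewrite !posrE !ltr0n !gt0 => /(_ isT isT) /eqP.
by rewrite eqr_nat => /eqP ab i; rewrite -lognE ab lognE.
Qed.

End Pairing.

Section Sieve.
Variable (K : comPzRingType).

Definition sieved N n := all (fun k => ~~ (nth_prime k %| n)%N) (iota 0 N).

Lemma sievedS N n : sieved N.+1 n = sieved N n && ~~ (nth_prime N %| n)%N.
Proof. by rewrite /sieved -addn1 iotaD all_cat /= andbT. Qed.

Lemma sievedM N n : sieved N (nth_prime N * n) = sieved N n.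
Proof.
apply: eq_in_all => k; rewrite mem_iota => /= kN.
rewrite Euclid_dvdM ?prime_nth_prime// dvdn_prime2 ?prime_nth_prime//.
by rewrite (inj_eq nth_prime_inj) (ltn_eqF kN).
Qed.

(** The least prime factor of [n] is not among the first [N] primes. *)
Lemma sieved_gt N n : sieved N n -> (1 < n)%N -> (N.+1 < n)%N.
Proof.
move=> sNn n1; have pp := pdiv_prime n1.
have [pN|Np] := ltnP (pdiv n) (nth_prime N).
  have [k kN kp] := nth_prime_onto pp pN.
  have := allP sNn k; rewrite mem_iota /= kN => /(_ isT).
  by rewrite kp pdiv_dvd.
rewrite (leq_trans (nth_prime_gt N))// (leq_trans Np)//.
by rewrite dvdn_leq ?pdiv_dvd// ltnW.
Qed.

Definition sieved_sum (f : nat -> K) N M :=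
  \sum_(1 <= n < M.+1 | sieved N n) f n.

(** One step of the sieve of Eratosthenes: the terms struck out are those at [p * m] with
    [m <= M %/ p], and [p * m] survives the earlier primes exactly when [m] does. *)
Lemma sieved_sumS (f : nat -> K) N M :
  (forall m n, (0 < m)%N -> (0 < n)%N -> f (m * n)%N = f m * f n) ->
  sieved_sum f N.+1 M =
  sieved_sum f N M - f (nth_prime N) * sieved_sum f N (M %/ nth_prime N).
Proof.
move=> fM; set p := nth_prime N.
have p0 : (0 < p)%N by rewrite prime_gt0 ?prime_nth_prime.
apply/eqP; rewrite eq_sym subr_eq; apply/eqP.
rewrite {1}/sieved_sum (bigID (fun n => ~~ (p %| n)%N)) /=; congr (_ + _).
  by apply: eq_bigl => n; rewrite sievedS.
rewrite (eq_bigl (fun n => (p %| n)%N && sieved N n)); last first.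
  by move=> n; rewrite negbK andbC.
rewrite -big_filter_cond (perm_big [seq (p * m)%N | m <- index_iota 1 (M %/ p).+1]).
  rewrite big_map /sieved_sum mulr_sumr /=.
  rewrite [LHS](eq_bigl (sieved N)); last by move=> m; rewrite sievedM.
  rewrite [LHS]big_seq_cond [RHS]big_seq_cond; apply: eq_bigr => m /andP[].
  rewrite mem_index_iota.
  by move=> /andP[m0 _] _; rewrite fM.
apply: uniq_perm.
- by rewrite filter_uniq// iota_uniq.
- by rewrite map_inj_uniq ?iota_uniq// => m n /eqP; rewrite eqn_pmul2l// => /eqP.
move=> n; rewrite mem_filter mem_index_iota; apply/andP/mapP.
  move=> [/dvdnP[m ->]] /andP[m0 mM]; exists m; last by rewrite mulnC.
  rewrite mem_index_iota; rewrite muln_gt0 in m0; case/andP: m0 => -> _ /=.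
  by rewrite ltnS leq_divRL.
move=> [m]; rewrite mem_index_iota => /andP[m0 mM] ->.
by rewrite dvdn_mulr// muln_gt0 p0 m0 ltnS mulnC -leq_divRL.
Qed.

End Sieve.

(** * Euler product *)

Section PSeries.
Variable R : realType.
Implicit Types (s t e : R) (n N M : nat) (x : nat -> R).

(** This is $n^{-s}$ for [n > 0], the modulus of the [n]-th term of the series. *)
Definition npow s n : R := expR (- (s * ln n%:R)).

Lemma npow_gt0 s n : 0 < npow s n.
Proof. exact: expR_gt0. Qed.

Lemma npow1 s : npow s 1 = 1.
Proof. by rewrite /npow ln1 mulr0 oppr0 expR0. Qed.

Lemma npowM s m n : (0 < m)%N -> (0 < n)%N ->
  npow s (m * n) = npow s m * npow s n.
Proof.
by move=> m0 n0; rewrite /npow natrM lnM ?posrE ?ltr0n// mulrDr opprD expRD.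
Qed.

Lemma npow_le s m n : 0 <= s -> (0 < m <= n)%N -> npow s n <= npow s m.
Proof.
move=> s0 /andP[m0 mn]; rewrite ler_expR lerN2 ler_wpM2l//.
by rewrite ler_ln ?posrE ?ltr0n ?ler_nat// (leq_trans m0).
Qed.

Lemma npow_lt s s' n : (1 < n)%N -> s < s' -> npow s' n < npow s n.
Proof.
by move=> n1 ss'; rewrite ltr_expR ltrN2 ltr_pM2r// ln_gt0// ltr1n.
Qed.

Lemma npow_le_half s n : 1 <= s -> (1 < n)%N -> npow s n <= 1 / 2.
Proof.
move=> s1 n1; have s0 : 0 <= s by lra.
have ln2 : 0 <= ln 2 :> R by rewrite ln_ge0// ler1n.
apply: (le_trans (npow_le s0 (_ : (0 < 2 <= n)%N))) => //.
rewrite /npow div1r -[leRHS]lnK ?posrE// ler_expR lnV ?posrE// lerN2.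
by rewrite ler_peMl.
Qed.

(* The right-hand side telescopes. *)
Lemma npow_telescope s n : 1 < s ->
  (s - 1) * npow s n.+2 <= npow (s - 1) n.+1 - npow (s - 1) n.+2.
Proof.
move=> s1; set d := s - 1; have d0 : 0 < d by rewrite subr_gt0.
have n0 : 0 < n.+2%:R :> R by rewrite ltr0n.
have -> : npow s n.+2 = npow d n.+2 / n.+2%:R.
  by rewrite /npow -[X in _ / X]lnK ?posrE// -expRN -expRD; congr expR; rewrite /d; ring.
have -> : npow d n.+1 = npow d n.+2 * expR (d * (ln n.+2%:R - ln n.+1%:R)).
  by rewrite /npow -expRD; congr expR; ring.
(* This is [ln q <= q - 1] at [q = n.+1 / n.+2]. *)
have ln_ge : n.+2%:R^-1 <= ln n.+2%:R - ln n.+1%:R :> R.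
  have q0 : 0 < n.+1%:R / n.+2%:R :> R by rewrite divr_gt0 ?ltr0n.
  have := expR_ge1Dx (ln (n.+1%:R / n.+2%:R : R)); rewrite lnK ?posrE//.
  rewrite ln_div ?posrE ?ltr0n// -lerBrDl.
  have -> : n.+1%:R / n.+2%:R - 1 = - n.+2%:R^-1 :> R.
    by rewrite -[in LHS]natr1; field; rewrite gt_eqF.
  by rewrite -[X in X <= _ -> _]opprB lerN2.
set B := d * (ln _ - _); have EB := expR_ge1Dx B.
have dB : d / n.+2%:R <= B by rewrite ler_pM2l.
have C0 := npow_gt0 d n.+2; rewrite mulrCA.
by rewrite -[X in _ - X]mulr1 -mulrBr ler_pM2l// (le_trans dB)// lerBrDl.
Qed.

Lemma cvg_npow_series s : 1 < s -> cvgn (series (fun n => npow s n.+1)).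
Proof.
move=> s1; have d0 : 0 < s - 1 by rewrite subr_gt0.
apply: nondecreasing_is_cvgn.
  by apply: nondecreasing_series => n _ _; exact/ltW/npow_gt0.
exists (1 + (s - 1)^-1) => _ [M _ <-].
apply: (@le_trans _ _ (series (fun n => npow s n.+1) M.+1)).
  by rewrite seriesEnat /= big_nat_recr//= lerDl ltW ?npow_gt0.
rewrite seriesEnat /= big_nat_recl//= npow1 lerD2l.
rewrite -[leRHS]mul1r ler_pdivlMr// mulrC mulr_sumr.
apply: (@le_trans _ _ (\sum_(0 <= n < M) (npow (s - 1) n.+1 - npow (s - 1) n.+2))).
  by apply: ler_sum => n _; exact: npow_telescope.
rewrite (@telescope_sumr_eq _ _ _ (fun n => - npow (s - 1) n.+1))//.
  by rewrite npow1 opprK addrC lerBlDr lerDl ltW ?npow_gt0.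
by move=> k _; rewrite opprK addrC.
Qed.

(** As the series is indexed from [npow s 1], this is the sum of $n^{-s}$ over [n > N]. *)
Definition npow_tail s N : R :=
  limn (series (fun n => npow s n.+1)) - series (fun n => npow s n.+1) N.

Lemma npow_tail_cvg0 s : 1 < s -> npow_tail s N @[N --> \oo] --> 0.
Proof.
move=> s1; rewrite -[X in _ --> X](subrr (limn (series (fun n => npow s n.+1)))).
by apply: cvgB; [exact: cvg_cst | exact: cvg_npow_series].
Qed.

Lemma npow_tail_ge s N M : 1 < s ->
  \sum_(N <= n < M) npow s n.+1 <= npow_tail s N.
Proof.
move=> s1; have nd : nondecreasing_seq (series (fun n => npow s n.+1)).
  by apply: nondecreasing_series => n _ _; exact/ltW/npow_gt0.
have lim_ge K : series (fun n => npow s n.+1) K <= limn (series (fun n => npow s n.+1)).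
  exact: nondecreasing_cvgn_le nd (cvg_npow_series s1) K.
have [MN|NM] := leqP M N.
  by rewrite big_geq// subr_ge0.
rewrite lerBrDl seriesEnat /= -big_cat_nat//=; last exact: ltnW.
exact: lim_ge.
Qed.

End PSeries.

(** * Polar form of the terms and convergence of the series *)

Section ZetaTerm.
Variable R : realType.
Implicit Types (s t : R) (n N M : nat) (x : nat -> R).

Definition zterm x s t n : R[i] :=
  (npow s n)%:C * cis (pairing n x - t * ln n%:R).

Lemma zeta_termE x s t n : zeta_term x (s +i* t) n = zterm x s t n.
Proof.
rewrite /zeta_term /zterm expC_im -/(cis _) /natpowC.
have -> : expC ((s +i* t) * (ln n%:R)%:C) =
    (expR (s * ln n%:R))%:C * cis (t * ln n%:R).
  by rewrite /expC; simpc.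
have -> : ((expR (s * ln n%:R))%:C * cis (t * ln n%:R))^-1 =
    (npow s n)%:C * cis (- (t * ln n%:R)).
  apply: mulr1_eq; rewrite mulrACA -cisD subrr cis0 mulr1 -rmorphM.
  by rewrite /npow -expRD subrr expR0.
by rewrite mulrCA cisD.
Qed.

Lemma ztermM x s t m n : (0 < m)%N -> (0 < n)%N ->
  zterm x s t (m * n) = zterm x s t m * zterm x s t n.
Proof.
move=> m0 n0; rewrite /zterm npowM// pairingM// natrM lnM ?posrE ?ltr0n//.
rewrite mulrACA -cisD rmorphM; congr (_ * cis _); ring.
Qed.

Lemma zterm1 x s t : zterm x s t 1 = 1.
Proof.
rewrite /zterm npow1 ln1 mulr0 subr0.
have := @pairingM R 1 1 x isT isT; rewrite -[LHS]addr0 => /addrI <-.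
by rewrite cis0 mulr1.
Qed.

Lemma normr_zterm x s t n : `|zterm x s t n| = (npow s n)%:C.
Proof. by rewrite normrM normr_cis mulr1 ger0_norm// ler0c ltW// npow_gt0. Qed.

Lemma cvg_complex (a b : R^nat) (la lb : R) :
  a @ \oo --> la -> b @ \oo --> lb ->
  (fun n => a n +i* b n : R[i]^o) @ \oo --> (la +i* lb : R[i]^o).
Proof.
move=> ala blb; apply/cvgrPdist_lt => -[e e']; rewrite ltcE /= => /andP[/eqP -> e0].
have e20 : 0 < e / 2 by rewrite divr_gt0.
move/cvgrPdist_lt : ala => /(_ _ e20) ala; move/cvgrPdist_lt : blb => /(_ _ e20) blb.
near=> n; have an : `|la - a n| < e / 2 by near: n.
have bn : `|lb - b n| < e / 2 by near: n.
rewrite normc_def ltcR /= -[ltRHS]ger0_norm ?(ltW e0)// -sqrtr_sqr.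
rewrite ltr_sqrt ?exprn_gt0//.
rewrite -(real_normK (num_real (la - _))) -(real_normK (num_real (lb - _))).
by have := normr_ge0 (la - a n); have := normr_ge0 (lb - b n); nra.
Unshelve. all: by end_near. Qed.

Lemma zeta_cvg x s t : 1 < s ->
  (sieved_sum (zterm x s t) 0 M : R[i]^o) @[M --> \oo] --> (zeta x (s +i* t) : R[i]^o).
Proof.
move=> s1.
(* With [g] the cosine or the sine, these are the real and imaginary parts of the series, both
   dominated by $\sum n^{-s}$. *)
have abs (g : R -> R) : (forall u, `|g u| <= 1) ->
    cvgn (series (fun n => npow s n.+1 * g (pairing n.+1 x - t * ln n.+1%:R))).
  move=> g1; apply: normed_cvg; apply: series_le_cvg (cvg_npow_series s1) => n /=.
  - exact: normr_ge0.
  - exact/ltW/npow_gt0.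
  by rewrite normrM gtr0_norm ?npow_gt0// ler_piMr// ltW ?npow_gt0.
have cosc := abs _ (@cos_max R). have sinc := abs _ (@sin_max R).
have zE : (fun M => sieved_sum (zterm x s t) 0 M : R[i]^o) =
    series (fun n => zeta_term x (s +i* t) n.+1).
  apply/funext => M; rewrite /sieved_sum big_mkcond big_add1 seriesEnat /=.
  by apply: eq_bigr => n _; rewrite zeta_termE.
have sumE : series (fun n => zeta_term x (s +i* t) n.+1) =
  (fun M => series (fun n => npow s n.+1 * cos (pairing n.+1 x - t * ln n.+1%:R)) M +i*
    series (fun n => npow s n.+1 * sin (pairing n.+1 x - t * ln n.+1%:R)) M : R[i]^o).
  apply/funext => M; rewrite !seriesEnat /=; elim: M => [|M IHM].
    by rewrite !big_geq.
  rewrite !big_nat_recr //= IHM zeta_termE /zterm /cis.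
  by simpc.
rewrite zE /zeta sumE; exact: cvgP (cvg_complex cosc sinc).
Qed.

End ZetaTerm.

Lemma cvg_sub_mul (K : numFieldType) (u v w : nat -> K) (c l l' : K) :
  (forall n, w n = u n - c * v n) ->
  (u : nat -> K^o) @ \oo --> (l : K^o) -> (v : nat -> K^o) @ \oo --> (l' : K^o) ->
  (w : nat -> K^o) @ \oo --> (l - c * l' : K^o).
Proof.
move=> /funext -> ul vl; apply: (@cvgB _ K^o) ul _.
exact: (@cvgMl_tmp K).
Qed.

Section Euler.
Variable R : realType.
Implicit Types (s t : R) (n N M : nat) (x : nat -> R).

(** Limit of [sieved_sumS]: since [M %/ p] tends to infinity with [M], each sieving step multiplies
    the limit by one Euler factor. *)
Lemma sieved_sum_cvg x s t N : 1 < s ->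
  (sieved_sum (zterm x s t) N M : R[i]^o) @[M --> \oo] -->
  (zeta x (s +i* t) * \prod_(k < N) (1 - zterm x s t (nth_prime k)) : R[i]^o).
Proof.
move=> s1; elim: N => [|N IHN].
  by rewrite big_ord0 mulr1; exact: zeta_cvg.
have p0 : (0 < nth_prime N)%N by rewrite prime_gt0 ?prime_nth_prime.
set l := zeta x _ * _ in IHN.
have IHN' := cvg_comp _ _ (@cvg_divnr _ p0) IHN.
rewrite big_ord_recr /= mulrA -/l mulrBr mulr1 [X in _ - X]mulrC.
apply: cvg_sub_mul IHN IHN' => M.
exact: (sieved_sumS _ _ (@ztermM R x s t)).
Qed.

(** Apart from the term 1 at [n = 1], only integers above [N + 1] survive the sieve. *)
Lemma sieved_sum_sub1 x s t N M : 1 < s -> (0 < M)%N ->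
  `|sieved_sum (zterm x s t) N M - 1| <= (npow_tail s N.+1)%:C.
Proof.
move=> s1 M0; have sieved1 : sieved N 1.
  apply/allP => k _; rewrite dvdn1; apply/negP => /eqP p1.
  by have := prime_nth_prime k; rewrite p1.
rewrite /sieved_sum big_mkcond big_nat_recl//= sieved1 zterm1 addrAC subrr add0r.
rewrite (le_trans (ler_norm_sum _ _ _))//.
apply: (@le_trans _ _ (\sum_(1 <= n < M | (N < n)%N) (npow s n.+1)%:C)).
  rewrite [leRHS]big_mkcond; apply: ler_sum_nat => n /andP[n1 _].
  have [sn|_] := boolP (sieved N n.+1).
    by rewrite ifT ?normr_zterm//; have := sieved_gt sn; exact.
  by rewrite normr0; case: ifP => // _; rewrite ler0c ltW ?npow_gt0.
rewrite -rmorph_sum lecR; apply: le_trans (npow_tail_ge N.+1 M s1).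
have [NM|NM] := ltnP N M; last first.
  rewrite big1_seq ?sumr_ge0// => [n _|n]; first exact/ltW/npow_gt0.
  by rewrite mem_index_iota => /andP[Nn /andP[_ nM]]; lia.
rewrite [leRHS](big_nat_widenl _ 1)//.
Qed.

Lemma euler_product_bound x s t N : 1 < s ->
  `|zeta x (s +i* t) * \prod_(k < N) (1 - zterm x s t (nth_prime k)) - 1|
  <= (npow_tail s N.+1)%:C.
Proof.
move=> s1; set l := _ * _; have := @sieved_sum_cvg x s t N s1; rewrite -/l.
move=> /cvgrPdist_le lim_l; rewrite normc_def lecR; apply/ler_addgt0Pr => e e0.
rewrite -lecR -normc_def rmorphD [leRHS]addrC.
have := lim_l e%:C; rewrite ltcR => /(_ e0) [M0 _ near_l].
have := near_l M0.+1 (leqnSn _) => /= lM.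
have := @sieved_sum_sub1 x s t N M0.+1 s1 isT => l1.
rewrite (le_trans _ (lerD lM l1))//.
by rewrite (le_trans _ (ler_normD _ _))// addrA subrK.
Qed.

End Euler.

(** * The argument of zeta *)

Section Angle.
Variable R : realType.
Implicit Types (r u s t : R) (n N M k : nat) (x : nat -> R).

(* The argument of [1 / (1 - r * cis u)] for [0 <= r < 1]. *)
Definition euler_arg r u : R := atan (r * sin u / (1 - r * cos u)).

Lemma euler_arg_den_gt0 r u : 0 <= r < 1 -> 0 < 1 - r * cos u.
Proof. by move=> /andP[r0 r1]; have := cos_le1 u; nra. Qed.

(** The real part [1 - r * cos u] is positive, so the arctangent of the slope is the argument
    itself, without a correction by [pi]. *)
Lemma euler_argP r u : 0 <= r < 1 ->
  exists2 rho, 0 < rho & 1 - r%:C * cis u = rho%:C * cis (- euler_arg r u).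
Proof.
move=> r01; have d0 := euler_arg_den_gt0 u r01.
set y := r * sin u / (1 - r * cos u); set d := 1 - _ in d0 y *.
have y0 : 0 < Num.sqrt (1 + y ^+ 2) by rewrite sqrtr_gt0 ltr_pwDl ?sqr_ge0.
exists (d * Num.sqrt (1 + y ^+ 2)); first by rewrite mulr_gt0.
have sin_atan : sin (atan y) = y * cos (atan y).
  by rewrite -{2}[y]atanK /tan divfK// cos_atan invr_eq0 gt_eqF.
rewrite /cis cosN sinN sin_atan /euler_arg -/y cos_atan; simpc.
have dy : d * y = r * sin u by rewrite /y mulrCA divff ?gt_eqF// mulr1.
rewrite -dy -/d; set S := Num.sqrt _ in y0 *; have S0 : S != 0 by rewrite gt_eqF.
by congr (_ +i* _); [|congr (- _)]; field.
Qed.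

Lemma atan_lip (a b : R) : `|atan a - atan b| <= `|a - b|.
Proof.
wlog ab : a b / b < a => [H|].
  have [|/H//|->] := ltgtP a b; last by rewrite !subrr.
  by move=> /H; rewrite distrC [leRHS]distrC.
have datan (z : R) : z \in `]b, a[%R -> is_derive z 1 atan (1 + z ^+ 2)^-1.
  by move=> _; exact: is_derive1_atan.
have catan : {within `[b, a], continuous atan}.
  by apply: derivable_within_continuous => z _; exact: derivable_atan.
have [c _ ->] := MVT ab datan catan.
rewrite normrM ler_piMl// ger0_norm ?invr_ge0 ?addr_ge0 ?sqr_ge0//.
by rewrite invf_le1 ?lerDl ?sqr_ge0// ltr_pwDl ?sqr_ge0.
Qed.

Lemma euler_arg_le r u : 0 <= r <= 1 / 2 -> `|euler_arg r u| <= 2 * r.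
Proof.
move=> /andP[r0 r1]; have r01 : 0 <= r < 1 by lra.
have d0 := euler_arg_den_gt0 u r01.
have := atan_lip (r * sin u / (1 - r * cos u)) 0; rewrite atan0 !subr0.
move=> /le_trans; apply; rewrite normrM normfV normrM (ger0_norm r0).
rewrite (gtr0_norm d0) ler_pdivrMr//.
have := sin_max u; have := cos_le1 u; have := normr_ge0 (sin u); nra.
Qed.

Definition zeta_arg_term x s t k : R :=
  euler_arg (npow s (nth_prime k)) (x k - t * ln (nth_prime k)%:R).

(** An argument that is not reduced modulo [2 * pi], which keeps it continuous in [t]; comparison
    with [Arg] therefore goes through cosines. *)
Definition zeta_arg x s t : R := limn (series (zeta_arg_term x s t)).

Lemma npow_prime01 s k : 1 <= s -> 0 <= npow s (nth_prime k) <= 1 / 2.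
Proof.
move=> s1; rewrite ltW ?npow_gt0// npow_le_half// prime_gt1//.
exact: prime_nth_prime.
Qed.

Lemma zeta_arg_term_le x s t k : 1 < s ->
  `|zeta_arg_term x s t k| <= 2 * npow s k.+1.
Proof.
move=> s1; rewrite (le_trans (euler_arg_le _ (npow_prime01 _ (ltW s1))))//.
rewrite ler_pM2l// npow_le//; first by lra.
exact: ltnW (nth_prime_gt k).
Qed.

Lemma cvg_zeta_arg x s t : 1 < s ->
  series (zeta_arg_term x s t) @ \oo --> zeta_arg x s t.
Proof.
move=> s1; apply: cvgP; apply: normed_cvg.
apply: series_le_cvg (is_cvg_seriesZ (k := 2) (cvg_npow_series s1)) => n /=.
- exact: normr_ge0.
- by rewrite mulr_ge0// ltW ?npow_gt0.
- exact: zeta_arg_term_le.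
Qed.

Lemma zeta_arg_tail x s t N : 1 < s ->
  `|zeta_arg x s t - series (zeta_arg_term x s t) N| <= 2 * npow_tail s N.
Proof.
move=> s1; set S := series _.
have : `|S M - S N| @[M --> \oo] --> `|zeta_arg x s t - S N|.
  by apply: cvg_norm; apply: cvgB; [exact: cvg_zeta_arg | exact: cvg_cst].
move=> /cvgr_to_le; apply; near=> M.
have NM : (N <= M)%N by near: M; exact: nbhs_infty_ge.
rewrite /S sub_series NM (le_trans (ler_norm_sum _ _ _))//.
rewrite (le_trans (ler_sum _ (fun k _ => zeta_arg_term_le x t k s1)))//.
by rewrite -mulr_sumr ler_pM2l// npow_tail_ge.
Unshelve. all: by end_near. Qed.

Lemma euler_product_arg x s t N : 1 < s ->
  exists2 rho, 0 < rho & \prod_(k < N) (1 - zterm x s t (nth_prime k)) =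
    rho%:C * cis (- series (zeta_arg_term x s t) N).
Proof.
move=> s1; elim: N => [|N [rho rho0 IHN]].
  exists 1 => //; rewrite big_ord0 seriesEnat /= big_geq//.
  by rewrite oppr0 cis0 mulr1.
rewrite big_ord_recr /= IHN /zterm pairing_nth_prime.
have [|rho' rho'0 ->] := @euler_argP (npow s (nth_prime N))
    (x N - t * ln (nth_prime N)%:R).
  by have := npow_prime01 N (ltW s1); lra.
exists (rho * rho'); first exact: mulr_gt0.
rewrite mulrACA -rmorphM -cisD !seriesEnat /= big_nat_recr//=.
by rewrite opprD.
Qed.

(** A zero would make the left side of [euler_product_bound] equal to 1 for every [N], while the
    tails tend to 0. *)
Lemma zeta_neq0 x s t : 1 < s -> zeta x (s +i* t) != 0.
Proof.
move=> s1; apply/eqP => z0.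
have := npow_tail_cvg0 s1 => /cvgrPdist_lt /(_ _ ltr01) [N _ tN].
have := @euler_product_bound R x s t N s1.
rewrite z0 mul0r sub0r normrN1 -[1]/(1%:C) lecR; apply/negP; rewrite -ltNge.
have := tN N.+1 (leqnSn _); rewrite /= sub0r normrN; exact/le_lt_trans/ler_norm.
Qed.

(** The product of [zeta] with the finite Euler product tends to 1 and has argument [b N]. Hence
    [sin (b N)] tends to 0 while [cos (b N)] is eventually nonnegative, so the limit [a - A] has
    cosine 1. *)
Lemma cos_Arg_zeta x s t : 1 < s ->
  cos (Arg (zeta x (s +i* t))) = cos (zeta_arg x s t).
Proof.
move=> s1; have z0 := zeta_neq0 x t s1.
have [_] := ArgP z0; rewrite expC_im -/(cis _).
set z := zeta x _; set a := Arg z; set A := zeta_arg x s t => zE.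
pose b N := a - series (zeta_arg_term x s t) N.
have b_cvg : b N @[N --> \oo] --> a - A.
  by apply: cvgB; [exact: cvg_cst | exact: cvg_zeta_arg].
have tail0 : npow_tail s N.+1 @[N --> \oo] --> 0.
  by have := npow_tail_cvg0 s1; rewrite -(cvg_shiftS (npow_tail s)).
have bE : \forall N \near \oo, `|sin (b N)| <= 2 * npow_tail s N.+1 /\ 0 <= cos (b N).
  move/cvgrPdist_le : tail0 => /(_ (1 / 2)) tail0; near=> N.
  have tN : npow_tail s N.+1 <= 1 / 2.
    have : `|0 - npow_tail s N.+1| <= 1 / 2.
      by near: N; apply: tail0; rewrite divr_gt0.
    by rewrite sub0r normrN => /(le_trans (ler_norm _)).
  have := @euler_product_bound R x s t N s1.
  have [rho rho0 ->] := @euler_product_arg x s t N s1.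
  have [q q0 zq] : exists2 q, 0 < q & `|z| = q%:C.
    by have := z0; rewrite -normr_gt0 normc_def ltcR => q0; eexists; first exact: q0.
  rewrite -/z {1}zE zq mulrACA -rmorphM -cisD -/(b N).
  set w := q * rho; have w0 : 0 < w by rewrite mulr_gt0.
  have -> : w%:C * cis (b N) - 1 = (w * cos (b N) - 1) +i* (w * sin (b N)).
    by rewrite /cis; simpc.
  move: tN; set T := npow_tail s N.+1 => T1.
  rewrite normc_def lecR /= => wT.
  have sq_le (u v : R) : Num.sqrt (u ^+ 2 + v ^+ 2) <= T -> `|u| <= T.
    by apply: le_trans; rewrite -sqrtr_sqr ler_wsqrtr// lerDl sqr_ge0.
  have /ler_normlP[wc1 wc2] := sq_le _ _ wT.
  have wsT : `|w * sin (b N)| <= T by apply: (sq_le _ (w * cos (b N) - 1)); rewrite addrC.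
  (* From [T <= 1 / 2] follows [w * cos (b N) >= 1 / 2], hence [w >= 1 / 2], which turns
     [w * |sin (b N)| <= T] into the bound [2 * T]. *)
  have cb0 : 0 < cos (b N) by rewrite -(pmulr_rgt0 _ w0); lra.
  split; last exact: ltW.
  rewrite normrM gtr0_norm// in wsT.
  by have := cos_le1 (b N); have := normr_ge0 (sin (b N)); nra.
have sin_cvg : sin (b N) @[N --> \oo] --> sin (a - A).
  by apply: continuous_cvg b_cvg; exact: continuous_sin.
have cos_cvg : cos (b N) @[N --> \oo] --> cos (a - A).
  by apply: continuous_cvg b_cvg; exact: continuous_cos.
have sin0 : sin (a - A) = 0.
  apply/eqP; rewrite -normr_le0.
  have t0 : 2 * npow_tail s N.+1 @[N --> \oo] --> 0.
    by rewrite -(mulr0 2); exact: cvgMl_tmp.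
  apply: (ler_cvg_to (cvg_norm sin_cvg) t0).
  by apply: filterS bE => N [].
have cos_ge0 : 0 <= cos (a - A).
  by apply: (cvgr_to_ge cos_cvg); apply: filterS bE => N [].
have cos1 : cos (a - A) = 1.
  by have := cos2Dsin2 (a - A); rewrite sin0; nra.
by rewrite -[a](subrK A) cosD cos1 sin0 mul1r mul0r subr0.
Unshelve. all: by end_near. Qed.

End Angle.

(** * Extremal values of the argument and comparison of abscissas *)

Section Extremal.
Variable R : realType.
Implicit Types (r u v s t e : R) (n N M k : nat) (x y : nat -> R).

(* This is [asin r], for [0 <= r < 1]. *)
Definition max_euler_arg r : R := atan (r / Num.sqrt (1 - r ^+ 2)).

Lemma max_euler_arg_lt r r' : 0 <= r -> r < r' -> r' < 1 ->
  max_euler_arg r < max_euler_arg r'.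
Proof.
move=> r0 rr' r'1; apply: lt_atan.
have S'0 : 0 < Num.sqrt (1 - r' ^+ 2) by rewrite sqrtr_gt0; nra.
have S0 : 0 < Num.sqrt (1 - r ^+ 2) by rewrite sqrtr_gt0; nra.
have SS' : Num.sqrt (1 - r' ^+ 2) <= Num.sqrt (1 - r ^+ 2).
  by rewrite ler_wsqrtr//; nra.
rewrite (@le_lt_trans _ _ (r / Num.sqrt (1 - r' ^+ 2)))//.
  by rewrite ler_wpM2l// lef_pV2.
by rewrite ltr_pM2r ?invr_gt0.
Qed.

(** After squaring, the comparison of slopes reduces to [(cos u - r) ^+ 2 >= 0]; equality at
    [cos u = r] is the source of [euler_arg_acos]. *)
Lemma euler_arg_le_max r u : 0 <= r < 1 -> `|euler_arg r u| <= max_euler_arg r.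
Proof.
move=> r01; have d0 := euler_arg_den_gt0 u r01; have /andP[r0 r1] := r01.
have S0 : 0 < Num.sqrt (1 - r ^+ 2) by rewrite sqrtr_gt0; nra.
have S2 : Num.sqrt (1 - r ^+ 2) ^+ 2 = 1 - r ^+ 2 by rewrite sqr_sqrtr//; nra.
suff : `|r * sin u / (1 - r * cos u)| <= r / Num.sqrt (1 - r ^+ 2).
  rewrite !ler_norml => /andP[H1 H2]; rewrite /euler_arg /max_euler_arg -atanN.
  by rewrite !le_atan.
rewrite normrM normfV normrM (ger0_norm r0) (gtr0_norm d0) -!mulrA ler_wpM2l//.
rewrite ler_pdivrMr// mulrC ler_pdivlMr//.
rewrite -ler_sqr ?nnegrE ?mulr_ge0 ?(ltW d0) ?(ltW S0)// exprMn S2.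
rewrite real_normK ?num_real// sin2cos2.
by have := sqr_ge0 (cos u - r); nra.
Qed.

Lemma euler_arg_acos r : 0 <= r < 1 -> euler_arg r (acos r) = max_euler_arg r.
Proof.
move=> /andP[r0 r1]; have rB : -1 <= r <= 1 by lra.
have S0 : 0 < Num.sqrt (1 - r ^+ 2) by rewrite sqrtr_gt0; nra.
have S2 : Num.sqrt (1 - r ^+ 2) ^+ 2 = 1 - r ^+ 2 by rewrite sqr_sqrtr//; nra.
rewrite /euler_arg /max_euler_arg acosK// sin_acos// -[r * r]/(r ^+ 2).
set S := Num.sqrt _ in S0 S2 *; rewrite -S2.
by congr atan; field; rewrite gt_eqF.
Qed.

Lemma euler_argN r u : euler_arg r (- u) = - euler_arg r u.
Proof. by rewrite /euler_arg cosN sinN mulrN mulNr atanN. Qed.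

(** Stated in terms of sines and cosines because Kronecker's theorem controls angles only modulo
    [2 * pi]. For [r <= 1 / 2] the denominators are at least [1 / 2], which bounds both coefficients
    by 1. *)
Lemma euler_arg_lip r u v : 0 <= r <= 1 / 2 ->
  `|euler_arg r u - euler_arg r v| <= `|sin u - sin v| + `|cos u - cos v|.
Proof.
move=> /andP[r0 r1]; have r01 : 0 <= r < 1 by lra.
have p0 := euler_arg_den_gt0 u r01; have q0 := euler_arg_den_gt0 v r01.
rewrite (le_trans (atan_lip _ _))//.
have -> : r * sin u / (1 - r * cos u) - r * sin v / (1 - r * cos v) =
  (r / (1 - r * cos v)) * (sin u - sin v) +
  (r * sin u / (1 - r * cos u)) * (r / (1 - r * cos v)) * (cos u - cos v).
  by field; rewrite !gt_eqF.
have ql1 : `|r / (1 - r * cos v)| <= 1.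
  rewrite normrM normfV (ger0_norm r0) (gtr0_norm q0) ler_pdivrMr//.
  by have := cos_le1 v; nra.
have pl1 : `|r * sin u / (1 - r * cos u)| <= 1.
  rewrite !normrM normfV (ger0_norm r0) (gtr0_norm p0) ler_pdivrMr//.
  by have := cos_le1 u; have := sin_max u; have := normr_ge0 (sin u); nra.
rewrite (le_trans (ler_normD _ _))// !normrM lerD// ler_piMl//.
  by rewrite -normrM.
by rewrite -!normrM normrM mulr_ile1.
Qed.

(** The squared chord between the two points of the unit circle is [2 - 2 * cos (u - v)]. *)
Lemma cis_close u v e : 0 <= e -> 1 - e ^+ 2 / 2 <= cos (u - v) ->
  `|sin u - sin v| + `|cos u - cos v| <= 2 * e.
Proof.
move=> e0; rewrite cosB => uv.
have H : (sin u - sin v) ^+ 2 + (cos u - cos v) ^+ 2 <= e ^+ 2.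
  by have := cos2Dsin2 u; have := cos2Dsin2 v; nra.
have sq (a b : R) : a ^+ 2 + b ^+ 2 <= e ^+ 2 -> `|a| <= e.
  move=> ab; rewrite -[leRHS]ger0_norm// -ler_sqr ?nnegrE// !real_normK ?num_real//.
  by rewrite (le_trans _ ab)// lerDl sqr_ge0.
by rewrite mulr2n mulrDl mul1r lerD ?(sq _ _ H)// (sq _ (sin u - sin v))// addrC.
Qed.

Lemma zeta_arg_approx y (v : nat -> R) N s e : 1 < s -> 0 < e -> exists t,
  `|series (zeta_arg_term y s t) N -
    \sum_(0 <= k < N) euler_arg (npow s (nth_prime k)) (v k)| <= e.
Proof.
move=> s1 e0; pose d := e / (2 * N.+1%:R).
have d0 : 0 < d by rewrite divr_gt0.
have [|t tP] := kronecker (fun j : 'I_N => y j - v j) (@ln_prime_free R N)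
  (_ : 0 < d ^+ 2 / 2); first by rewrite divr_gt0 ?exprn_gt0.
(* The phases of [zeta_arg_term] carry [- t * ln p], those of [kronecker] carry [+ l j * t]. *)
exists (- t); rewrite seriesEnat /= -sumrB (le_trans (ler_norm_sum _ _ _))//.
apply: (@le_trans _ _ (\sum_(0 <= k < N) 2 * d)).
  apply: ler_sum_nat => k /andP[_ kN].
  rewrite (le_trans (euler_arg_lip _ _ (npow_prime01 k (ltW s1))))//.
  apply: cis_close; first exact: ltW.
  have := tP (Ordinal kN); rewrite /= => /le_trans; apply.
  by rewrite le_eqVlt; apply/orP; left; apply/eqP; congr cos; ring.
rewrite sumr_const_nat subn0 -[leRHS](_ : 2 * d *+ N.+1 = e).
  by apply: ler_wpMn2l; [rewrite mulr_ge0// ltW | exact: leqnSn].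
by rewrite -mulr_natr mulrAC mulrC divfK// mulf_neq0 ?pnatr_eq0.
Qed.

(** The tail bound does not depend on [t], so this is a uniform limit of continuous partial sums. *)
Lemma zeta_arg_continuous y s : 1 < s -> continuous (zeta_arg y s).
Proof.
move=> s1 t0.
have cterm k : continuous (fun t => zeta_arg_term y s t k).
  move=> t; have ph : y k - u * ln (nth_prime k)%:R @[u --> t] -->
      y k - t * ln (nth_prime k)%:R.
    by apply: cvgB; [exact: cvg_cst | apply: cvgMr_tmp; exact: cvg_id].
  apply: (@continuous_cvg _ _ _ _ _ _ (@atan R)); first exact: continuous_atan.
  apply: cvgM.
    by apply: cvgMl_tmp; apply: continuous_cvg ph; exact: continuous_sin.
  apply: cvgV.
    by rewrite gt_eqF// euler_arg_den_gt0//; have := npow_prime01 k (ltW s1); lra.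
  apply: cvgB; first exact: cvg_cst.
  by apply: cvgMl_tmp; apply: continuous_cvg ph; exact: continuous_cos.
have cS N : continuous (fun t => series (zeta_arg_term y s t) N).
  move=> t; elim: N => [|N IHN].
    by rewrite (_ : (fun _ => _) = cst 0); [exact: cvg_cst |
      apply/funext => u; rewrite seriesEnat /= big_geq].
  rewrite (_ : (fun _ => _) =
      (fun u => series (zeta_arg_term y s u) N + zeta_arg_term y s u N)).
    by apply: cvgD => //; exact: cterm.
  by apply/funext => u; rewrite !seriesEnat /= big_nat_recr.
apply/cvgrPdist_lt => e e0.
(* Two tails of at most [2 * e / 5] each and a variation of the partial sum below [e / 5] make up
   [e]. *)
have := npow_tail_cvg0 s1 => /cvgrPdist_lt /(_ (e / 5)) [|N _ tN].
  by rewrite divr_gt0.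
have {}tN : npow_tail s N < e / 5.
  have := tN N (leqnn _); rewrite /= sub0r normrN; exact/le_lt_trans/ler_norm.
have := cS N t0 => /cvgrPdist_lt /(_ (e / 5)) cSN.
near=> t; have /ltr_normlP[St1 St2] : `|series (zeta_arg_term y s t0) N -
    series (zeta_arg_term y s t) N| < e / 5.
  by near: t; apply: cSN; rewrite divr_gt0.
have /ler_normlP[? ?] := @zeta_arg_tail R y s t N s1.
have /ler_normlP[? ?] := @zeta_arg_tail R y s t0 N s1.
by apply/ltr_normlP; split; lra.
Unshelve. all: by end_near. Qed.

Lemma zeta_arg_attained x y s0 s1 t0 a : 1 < s1 < s0 ->
  `|a| <= `|zeta_arg x s0 t0| -> exists t, zeta_arg y s1 t = a.
Proof.
move=> /andP[s1_gt1 s10] aA; have s0_gt1 := lt_trans s1_gt1 s10.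
pose m s k := max_euler_arg (npow s (nth_prime k)).
have npow01 s k : 1 < s -> 0 <= npow s (nth_prime k) < 1.
  by move=> /ltW /(npow_prime01 k); lra.
(* The gain at the prime 2 alone; [N > 0] below ensures that this prime enters the partial sums. *)
pose d := m s1 0%N - m s0 0%N; have d0 : 0 < d.
  have := npow01 s0 0%N s0_gt1; have := npow01 s1 0%N s1_gt1.
  move=> /andP[_ ?] /andP[? _]; rewrite subr_gt0 max_euler_arg_lt//.
  exact: npow_lt.
have [N N0 [tN0 tN1]] : exists2 N, (0 < N)%N &
   (npow_tail s0 N <= d / 8) /\ (npow_tail s1 N <= d / 8).
  have tl s : 1 < s -> \forall N \near \oo, npow_tail s N <= d / 8.
    move=> s_gt1; have /cvgrPdist_le := npow_tail_cvg0 s_gt1.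
    move=> /(_ (d / 8)) H; have {}H := H (divr_gt0 d0 (ltr0n _ 8)).
    by apply: filterS H => N; rewrite sub0r normrN => /(le_trans (ler_norm _)).
  have [N [[? ?] ?]] := filter_ex (filterI (filterI (tl _ s0_gt1) (tl _ s1_gt1))
    (nbhs_infty_gt 0%N)).
  by exists N.
pose Sm s := \sum_(0 <= k < N) m s k.
have Sm_gap : Sm s0 + d <= Sm s1.
  rewrite /Sm /d; case: (N) N0 => // M _; rewrite big_nat_recl// [leRHS]big_nat_recl//.
  rewrite addrAC [m s0 _ + (_ - _)]addrC subrK lerD2l.
  apply: ler_sum => k _; rewrite ltW// max_euler_arg_lt//.
  - by have /andP[] := npow01 s0 k.+1 s0_gt1.
  - by rewrite npow_lt// prime_gt1// prime_nth_prime.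
  - by have /andP[] := npow01 s1 k.+1 s1_gt1.
have SA : `|series (zeta_arg_term x s0 t0) N| <= Sm s0.
  rewrite seriesEnat /= (le_trans (ler_norm_sum _ _ _))//.
  by apply: ler_sum => k _; exact: euler_arg_le_max (npow01 _ _ s0_gt1).
have tail0 := @zeta_arg_tail R x s0 t0 N s0_gt1.
(* A tail error of [d / 4] at [s0] leaves [3 * d / 4] of the gap. At [s1], the approximation and the
   tail cost [d / 4] each, so [a] still lies between the values at [t2] and [t1]. *)
have aSm : `|a| <= Sm s1 - 3 * d / 4.
  have := ler_normD (zeta_arg x s0 t0 - series (zeta_arg_term x s0 t0) N)
    (series (zeta_arg_term x s0 t0) N); rewrite subrK; lra.
have d4 : 0 < d / 4 by rewrite divr_gt0.
pose v k := acos (npow s1 (nth_prime k)).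
have [t1] := zeta_arg_approx y v N s1_gt1 d4.
have [t2] := zeta_arg_approx y (fun k => - v k) N s1_gt1 d4.
under eq_bigr do rewrite euler_argN euler_arg_acos ?npow01//.
rewrite sumrN -/(Sm s1) opprK => t2P.
under eq_bigr do rewrite euler_arg_acos ?npow01//.
rewrite -/(Sm s1) => t1P.
have /ler_normlP[? ?] := @zeta_arg_tail R y s1 t1 N s1_gt1.
have /ler_normlP[? ?] := @zeta_arg_tail R y s1 t2 N s1_gt1.
move: t1P t2P aSm => /ler_normlP[? ?] /ler_normlP[? ?] /ler_normlP[? ?].
have lo : zeta_arg y s1 t2 <= a by lra.
have hi : a <= zeta_arg y s1 t1 by lra.
have cont b c : {within `[b, c], continuous (zeta_arg y s1)}.
  exact/continuous_subspaceT/zeta_arg_continuous.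
have [t12|/ltW t21] := leP t1 t2.
  have [|c _ cE] := IVT t12 (cont _ _) (_ : _ <= a <= _); last by exists c.
  by rewrite ge_min le_max lo hi orbT.
have [|c _ cE] := IVT t21 (cont _ _) (_ : _ <= a <= _); last by exists c.
by rewrite ge_min le_max lo hi orbT.
Qed.

Lemma normr_Arg (z : R[i]) : z != 0 -> `|Arg z| \in `[0, pi]%R.
Proof.
move=> /ArgP[/andP[? ?] _]; rewrite in_itv /= normr_ge0 /= ler_norml; apply/andP.
by split => //; exact: ltW.
Qed.

Lemma sigma_le theta x y : (sigma theta x <= sigma theta y)%E.
Proof.
apply: ge_ereal_sup => _ [s0 [s0_gt1 [t0 Et0]] <-].
apply/lee_addgt0Pr => e e0.
(* The first entry limits the loss to [e]; the midpoint keeps [s1] above 1. *)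
pose s1 := Num.max (s0 - e) ((1 + s0) / 2).
have s10 : 1 < s1 < s0 by rewrite gt_max lt_max; lra.
have [s1_gt1 _] := andP s10.
have theta_pi : `|theta| \in `[0, pi]%R.
  by rewrite -Et0 normr_id normr_Arg ?zeta_neq0.
(* If [|zeta_arg|] were smaller than [|theta|], both would lie in [[0, pi]] with equal cosines, and
   injectivity of the cosine there would make them equal. *)
have theta_le : `|theta| <= `|zeta_arg x s0 t0|.
  rewrite leNgt; apply/negP => Atheta; have := Atheta.
  rewrite (@cos_inj R `|zeta_arg x s0 t0| `|theta|) ?ltxx//.
    move: theta_pi; rewrite !in_itv /= !normr_ge0 /=.
    exact/le_trans/ltW.
  by rewrite !cos_norm -cos_Arg_zeta// -Et0 cos_norm.
have [t1 t1E] := zeta_arg_attained y s10 theta_le.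
apply: (@le_trans _ _ (s1%:E + e%:E)%E).
  by rewrite -EFinD lee_fin -lerBlDr le_max lexx.
rewrite leeD2r//; apply: ereal_sup_ubound; exists s1 => //; split => //.
exists t1; apply: (@cos_inj R); rewrite ?normr_Arg ?zeta_neq0//.
  by rewrite -Et0 normr_Arg ?zeta_neq0.
by rewrite cos_norm cos_Arg_zeta// t1E.
Qed.

End Extremal.

Theorem lemma3p4 (R : realType) (theta : R) (htheta : 0 <= theta <= pi)
    (x : nat -> R) :
  (sigma theta x <= sigma theta (fun=> (pi / 2)%R))%E /\
  sigma theta (fun=> (pi / 2)%R) = sigma theta (fun=> (- (pi / 2))%R).
Proof.
split; first exact: sigma_le.
by apply: le_anti; apply/andP; split; exact: sigma_le.
Qed.
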